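(* Let $V=V_{-1}\oplus V_0\oplus V_1$ with $V_{-1}=\langle u\rangle$, $V_0=\langle v\rangle$, $V_1=\langle w\rangle$ one-dimensional, and consider skew symmetric linear operators $l_n:V^{\otimes n}\to V$ of degree $2-n$ ($n\ge1$) given by constants $a_n,b_n,c_n$ via $$l_n(u\otimes v\otimes w^{\otimes n-2})=a_n u\ (n\ge2),\qquad l_n(u\otimes w^{\otimes n-1})=b_n v\ (n\ge1),\qquad l_n(v\otimes w^{\otimes n-1})=c_n w\ (n\ge1),$$ and $a_1:=0$. Every $L_\infty$ structure on $V$ given by such operators has one of the following forms: (i) $b_n=0$ for all $n$, while the constants $a_n$ ($n\ge2$) and $c_n$ ($n\ge1$) are arbitrary; (ii) $b_m\ne0$ for some $m$, while all constants $a_n$, $c_n$ are zero.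
   Context: All vector spaces are graded, over a fixed field of characteristic zero; $|x|$ is the degree of $x$. For a permutation $\sigma$ of a string of homogeneous elements, $\varepsilon(\sigma)$ is the Koszul sign (a factor $(-1)^{pq}$ whenever elements of degrees $p$ and $q$ are commuted) and $\chi(\sigma)=(-1)^{\sigma}\varepsilon(\sigma)$, where $(-1)^\sigma$ is the sign of $\sigma$. A $(p,n-p)$ unshuffle is $\sigma\in S_n$ with $\sigma(1)<\dots<\sigma(p)$ and $\sigma(p+1)<\dots<\sigma(n)$. A linear map $l:V^{\otimes n}\to V$ has degree $k$ if $l(x_1\otimes\dots\otimes x_n)\in V_N$ with $N=k+\sum|x_i|$; it is skew symmetric if $l(x_{\pi(1)}\otimes\dots\otimes x_{\pi(n)})=\chi(\pi)\,l(x_1\otimes\dots\otimes x_n)$ for all $\pi\in S_n$. Given skew symmetric maps $l_k$, define $\mathcal J_n:V^{\otimes n}\to V$ by $$\mathcal J_n(x_1\otimes\dots\otimes x_n)=\sum_{p=1}^n(-1)^{p(n-p)}\sum_{\sigma\ (p,n-p)\text{ unshuffle}}\chi(\sigma)\,l_{n-p+1}\big(l_p(x_{\sigma(1)}\otimes\dots\otimes x_{\sigma(p)})\otimes x_{\sigma(p+1)}\otimes\dots\otimes x_{\sigma(n)}\big).$$ An $L_\infty$ structure on $V$ is a family of skew symmetric linear maps $l_k:V^{\otimes k}\to V$, $k\ge1$, of degree $2-k$, with $\mathcal J_n=0$ for all $n\ge1$. In the claim, $u,v,w$ have degrees $-1,0,1$, and all other graded components of $V$ are zero. The values of $l_n$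 on permutations of the listed tensors are determined by skew symmetry; $l_n$ vanishes on all other tensors of basis vectors. *)

(* Defs.v *)
From HB Require Import structures.
From mathcomp Require Import all_boot all_order all_fingroup all_algebra.
Set Implicit Arguments.
Unset Strict Implicit.
Unset Printing Implicit Defensive.
Import GRing.Theory.
Local Open Scope ring_scope.

Section GradedOperators.

Variables (K : fieldType) (V : vectType K).

(* A map out of the n-th tensor power of V is a multilinear map on n-tuples.
   The component of arity 0 is never used. *)
Definition operators := forall n : nat, n.-tuple V -> V.

Definition apply (l : operators) (s : seq V) : V := l (size s) (in_tuple s).

(* x_(pi(1)), ..., x_(pi(n)) *)
Definition rearrange (n : nat) (x : n.-tuple V) (pi : 'S_n) : n.-tuple V :=
  [tuple tnth x (pi i) | i < n].

(* Sign of the passage from x_1, ..., x_n to x_(pi(1)), ..., x_(pi(n)), where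
   x_i has degree d_i: each pair whose relative order is reversed contributes
   once. *)
Definition koszul (n : nat) (d : n.-tuple int) (pi : 'S_n) : K :=
  \prod_(i < n) \prod_(j < n | (i < j)%N && (pi j < pi i)%N)
     (-1) ^ (tnth d (pi i) * tnth d (pi j)).

Definition chi (n : nat) (d : n.-tuple int) (pi : 'S_n) : K :=
  (-1) ^+ odd_perm pi * koszul d pi.

Definition unshuffle (n p : nat) (s : 'S_n) : bool :=
  [forall i : 'I_n, forall j : 'I_n,
     (i < j)%N && ((j < p)%N || (p <= i)%N) ==> (s i < s j)%N].

Definition multilinear (l : operators) : Prop :=
  forall (s1 s2 : seq V) (k : K) (y z : V),
    apply l (s1 ++ (k *: y + z) :: s2) =
      k *: apply l (s1 ++ y :: s2) + apply l (s1 ++ z :: s2).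

Variable gr : int -> {vspace V}.

Definition homogeneous (n : nat) (d : n.-tuple int) (x : n.-tuple V) : Prop :=
  forall i : 'I_n, tnth x i \in gr (tnth d i).

Definition skew_symmetric (l : operators) : Prop :=
  forall (n : nat) (d : n.-tuple int) (x : n.-tuple V) (pi : 'S_n),
    (0 < n)%N -> homogeneous d x ->
    l n (rearrange x pi) = chi d pi *: l n x.

Definition degree_2_minus_n (l : operators) : Prop :=
  forall (n : nat) (d : n.-tuple int) (x : n.-tuple V),
    (0 < n)%N -> homogeneous d x ->
    l n x \in gr (2%:Z - n%:Z + \sum_(i < n) tnth d i).

(* J_n(x_1, ..., x_n) for x_i homogeneous of degree d_i. *)
Definition jacobi (l : operators) (n : nat) (d : n.-tuple int)
    (x : n.-tuple V) : V :=
  \sum_(1 <= p < n.+1) (-1) ^+ (p * (n - p)) *: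
    \sum_(s : 'S_n | unshuffle p s)
      chi d s *: apply l (apply l (take p (rearrange x s))
                            :: drop p (rearrange x s)).

Definition graded_operators (l : operators) : Prop :=
  [/\ multilinear l, skew_symmetric l & degree_2_minus_n l].

Definition Linfty_structure (l : operators) : Prop :=
  graded_operators l /\
  forall (n : nat) (d : n.-tuple int) (x : n.-tuple V),
    (0 < n)%N -> homogeneous d x -> jacobi l d x = 0.

Variables (u v w : V).

Definition given_by_constants (a b c : nat -> K) (l : operators) : Prop :=
  [/\ forall n, (2 <= n)%N ->
        apply l [:: u, v & nseq (n - 2) w] = a n *: u,
      forall n, (1 <= n)%N ->
        apply l (u :: nseq (n - 1) w) = b n *: v,
      forall n, (1 <= n)%N ->
        apply l (v :: nseq (n - 1) w) = c n *: w
    & forall s : seq V, (1 <= size s)%N -> {subset s <= [:: u; v; w]} ->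
        ~~ ((2 <= size s)%N && perm_eq s [:: u, v & nseq (size s - 2) w]) ->
        ~~ perm_eq s (u :: nseq (size s - 1) w) ->
        ~~ perm_eq s (v :: nseq (size s - 1) w) ->
        apply l s = 0].

End GradedOperators.

(* Main.v *)
Require Import Defs.
From HB Require Import structures.
From mathcomp Require Import all_boot all_order all_fingroup all_algebra.
From mathcomp Require Import ring zify.
From Stdlib Require Classical_Prop.
Set Implicit Arguments.
Unset Strict Implicit.
Unset Printing Implicit Defensive.
Import GRing.Theory.
Local Open Scope ring_scope.

(** The sign rule for exchanging neighbours makes [u] and [w], which have odd
    degree, commute, and makes [v] anticommute with everything, itself included.
    So a skew symmetric operator is a linear function of the product of its
    arguments in an algebra where [u] and [w] commute, [v] anticommutes with
    them and has square zero. Reading off the coefficients of u v w^(n-2),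
    u w^(n-1) and v w^(n-1) gives operators with arbitrary prescribed constants
    ([explicit_graded], [explicit_given]), and there are no others
    ([graded_given_unique]). The Jacobi sums thereby become combinations of
    convolutions of these coefficients ([jacobi_formula]).

    If all [b n] vanish, then [u] and [w] are the only values, and a composite
    of two operators can be nonzero only if its inner and its outer arguments
    contain one [v] each. Exchanging these two arguments changes only the sign
    of the term, so the Jacobi sums vanish ([split_sum_coefV], based on
    [unshuffle_sum_cancel]). If instead all [a n] and [c n] vanish, the inner
    operator yields a multiple of [v], which the outer operator annihilates.

    Conversely let [m] be minimal with [b m] nonzero. On words in [u] and [w] all
    signs are [+1], an inner operator of arity [p] produces [b p] times a multiple
    of [v], and the outer one, of arity [q], turns this into multiples of [a q] or
    [c q]. For the smallest [k] with [a k] or [c k] nonzero, the total arity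
    [m + k - 1] leaves only the terms with [p = m] and [q = k]. These are counted
    by a positive integer, which is nonzero in characteristic zero; so [b m * a k]
    or [b m * c k] would have to vanish ([nontrivial_b_vanishing]). *)

(** * Signs of rearrangements *)

(** Moving one letter at a time exchanges two adjacent blocks, and exchanges of
    blocks generate all rearrangements. *)
Lemma adjacent_swaps_perm (T : eqType) (R : Type) (F : seq T -> R) :
  (forall s1 x y s2, F (s1 ++ x :: y :: s2) = F (s1 ++ y :: x :: s2)) ->
  forall s t, perm_eq s t -> F s = F t.
Proof.
move=> swapF.
have move1 p x s2 s3 : F (p ++ x :: s2 ++ s3) = F (p ++ s2 ++ x :: s3).
  elim: s2 p => [|y s2 IHs] p //=.
  by rewrite swapF -cat_rcons IHs cat_rcons.
have block p s1 s2 s3 :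
    F (p ++ s1 ++ s2 ++ s3) = F (p ++ s2 ++ s1 ++ s3).
  elim: s1 p => [|x s1 IHs] p //=.
  by rewrite -cat_rcons IHs cat_rcons move1.
exact: catCA_perm_subst (block [::]).
Qed.

Section Signs.
Variable K : fieldType.

Definition oddz (m : int) : bool := odd `|m|%N.

(** The sign [- (-1) ^ (a * b)] of exchanging neighbours of degrees [a] and [b],
    written by parity: skew symmetric operators are symmetric in two entries of
    odd degree, and change sign as soon as one of the two has even degree. *)
Definition swap_sign (a b : int) : K := if oddz a && oddz b then 1 else -1.

Lemma swap_signC a b : swap_sign a b = swap_sign b a.
Proof. by rewrite /swap_sign andbC. Qed.

Lemma swap_sign_sq a b : swap_sign a b * swap_sign a b = 1.
Proof. by rewrite /swap_sign; case: ifP; rewrite ?mulr1 // mulrNN mulr1. Qed.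

Lemma exprz_sign (m : int) : (-1 : K) ^ m = (-1) ^+ oddz m.
Proof.
rewrite /oddz signr_odd; case: m => k //=.
by rewrite NegzE -exprz_inv invrN invr1.
Qed.

Lemma swap_signE a b : swap_sign a b = -1 * (-1) ^ (a * b).
Proof.
rewrite exprz_sign /oddz abszM oddM /swap_sign /oddz.
by case: (_ && _); rewrite ?expr0 ?expr1 ?mulr1 ?mulrNN ?mulr1.
Qed.

(** The parity of a permutation is the parity of its number of inversions. The
    induction splits off the value at the first position: it contributes one
    inversion for each smaller value, and removing it leaves the order of the
    remaining values unchanged. *)
Lemma prod_inversions n (s : 'S_n) :
  \prod_(i < n) \prod_(j < n | (i < j)%N && (s j < s i)%N) (-1)
    = (-1) ^+ odd_perm s :> K.
Proof.
elim: n s => [|n IHn] s; first by rewrite big_ord0 permS0 odd_perm1 expr0.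
have [t def_s] : exists t, s = lift_perm ord0 (s ord0) t.
  have lift_s i : exists j, s (lift ord0 i) = lift (s ord0) j.
    have /unlift_some[j ->] : s ord0 != s (lift ord0 i).
      by rewrite (inj_eq perm_inj) neq_lift.
    by exists j.
  pose f i := odflt i (unlift (s ord0) (s (lift ord0 i))).
  have fE i : s (lift ord0 i) = lift (s ord0) (f i).
    by rewrite /f; have [j ->] := lift_s i; rewrite liftK.
  have inj_f : injective f.
    move=> i j eq_f; apply: (@lift_inj _ ord0); apply: (@perm_inj _ s).
    by rewrite !fE eq_f.
  exists (perm inj_f); apply/permP => i; case: (unliftP ord0 i) => [j|] ->.
    by rewrite lift_perm_lift permE fE.
  by rewrite lift_perm_id.
have -> : odd_perm s = odd (s ord0) (+) odd_perm t.
  by rewrite [in LHS]def_s odd_lift_perm.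
rewrite big_ord_recl signr_addb -IHn.
set j0 := s ord0 in def_s *; congr (_ * _).
  rewrite big_mkcond big_ord_recl /= mul1r.
  rewrite (eq_bigr (fun k : 'I_n => if (t k < j0)%N then -1 else 1 : K)).
    transitivity (\prod_(k < n | (k < j0)%N) (-1) : K).
      by rewrite [RHS]big_mkcond [RHS](reindex_inj (@perm_inj _ t)).
    have le_j0n : (j0 <= n)%N by rewrite -ltnS.
    have := big_ord_widen n (fun _ => -1 : K) le_j0n => /= <-.
    by rewrite prodr_const card_ord signr_odd.
  move=> k _; rewrite [in s _]def_s lift_perm_lift /= /bump.
  congr (if _ then _ else _).
  by case: (leqP j0 (t k)) => ? /=; lia.
apply: eq_bigr => i _; rewrite big_mkcond big_ord_recl /= mul1r.
rewrite [RHS]big_mkcond; apply: eq_bigr => k _.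
rewrite def_s !lift_perm_lift /= /bump !leq0n !add1n ltnS.
congr (if _ && _ then _ else _).
by do 2!case: leqP => ? /=; lia.
Qed.

(** Distributing the sign of the permutation over its inversions turns [chi]
    into a product of signs of single transpositions, one per inversion. *)
Lemma chi_inversions n (d : n.-tuple int) (s : 'S_n) :
  chi K d s = \prod_(i < n) \prod_(j < n | (i < j)%N && (s j < s i)%N)
                swap_sign (tnth d (s i)) (tnth d (s j)).
Proof.
rewrite /chi /koszul -prod_inversions -big_split; apply: eq_bigr => i _.
by rewrite -big_split; apply: eq_bigr => j _; rewrite swap_signE.
Qed.

Section Words.
Variables (n : nat) (d : n.-tuple int).
Implicit Types (s t : seq 'I_n) (i j : 'I_n).

(** The value [0] on equal letters makes [pair_signC], and with it
    [word_sign_swap], hold for all words; it does not occur in words without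
    repetitions. *)
Definition pair_sign i j : K :=
  if (i < j)%N then 1
  else if (j < i)%N then swap_sign (tnth d i) (tnth d j) else 0.

(** [chi] extended from permutations to words in the index set. On words,
    adjacent exchanges can be made one at a time, and words can be cut into
    blocks and concatenated again. *)
Fixpoint word_sign s : K :=
  if s is i :: s' then (\prod_(j <- s') pair_sign i j) * word_sign s' else 1.

Lemma pair_signC i j :
  pair_sign i j = swap_sign (tnth d i) (tnth d j) * pair_sign j i.
Proof.
rewrite /pair_sign; case: ltngtP; rewrite ?mulr1 ?mulr0 //.
by rewrite [swap_sign (tnth d j) _]swap_signC swap_sign_sq.
Qed.

Lemma word_sign_swap s1 i j s2 :
  word_sign (s1 ++ i :: j :: s2)
    = swap_sign (tnth d i) (tnth d j) * word_sign (s1 ++ j :: i :: s2).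
Proof.
elim: s1 => [|k s1 IHs] /=.
  by rewrite !big_cons pair_signC; ring.
rewrite IHs !big_cat /= !big_cons; ring.
Qed.

Lemma word_sign_sq s : uniq s -> word_sign s * word_sign s = 1.
Proof.
elim: s => [|i s IHs] /=; first by rewrite mulr1.
case/andP=> s'i /IHs{IHs}; set q := word_sign s => q2.
rewrite mulrACA q2 mulr1 -big_split /= big_seq big1 // => j sj.
rewrite /pair_sign; case: ltngtP; rewrite ?mulr1 ?swap_sign_sq //.
by move/val_inj => eq_ij; rewrite eq_ij sj in s'i.
Qed.

Lemma word_signE i0 s : uniq s ->
  word_sign s
    = \prod_(k < size s) \prod_(l < size s | (k < l)%N
          && (nth i0 s l < nth i0 s k)%N)
        swap_sign (tnth d (nth i0 s k)) (tnth d (nth i0 s l)).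
Proof.
elim: s => [|i s IHs] /=; first by rewrite big_ord0.
case/andP=> s'i /IHs{IHs} ->; rewrite big_ord_recl; congr (_ * _).
  rewrite [RHS]big_mkcond big_ord_recl /= mul1r (big_nth i0) big_mkord.
  apply: eq_bigr => k _; rewrite /= /pair_sign; case: ltngtP => //.
  by move/val_inj => eq_i; rewrite eq_i mem_nth in s'i.
apply: eq_bigr => k _; rewrite [RHS]big_mkcond big_ord_recl /= mul1r.
by rewrite big_mkcond.
Qed.

Definition word_of (p : 'S_n) : seq 'I_n := [seq p i | i <- enum 'I_n].

Lemma word_of1 : word_of 1 = enum 'I_n.
Proof. by rewrite /word_of -[RHS]map_id; apply: eq_map => i; rewrite perm1. Qed.

Lemma perm_word_of p : perm_eq (word_of p) (enum 'I_n).
Proof.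
apply: uniq_perm; rewrite ?enum_uniq //.
  by rewrite map_inj_uniq ?enum_uniq //; apply: perm_inj.
move=> i; rewrite mem_enum -[i in LHS](permKV p) map_f //.
by rewrite mem_enum.
Qed.

Lemma word_of_uniq p : uniq (word_of p).
Proof. by rewrite (perm_uniq (perm_word_of p)) enum_uniq. Qed.

Lemma size_word_of p : size (word_of p) = n.
Proof. by rewrite size_map size_enum_ord. Qed.

Lemma word_sign_of p : word_sign (word_of p) = chi K d p.
Proof.
rewrite chi_inversions; case: (posnP n) => [n0|n_gt0].
  have -> : word_of p = [::] by apply/nilP; rewrite /nilp size_word_of n0.
  by rewrite big1 // => i; have := ltn_ord i; rewrite [X in (_ < X)%N]n0.
pose i0 := Ordinal n_gt0; rewrite (word_signE i0) ?word_of_uniq //.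
have nthw (k : 'I_n) : nth i0 (word_of p) k = p k.
  by rewrite (nth_map i0) ?size_enum_ord // nth_ord_enum.
rewrite size_word_of; apply: eq_bigr => k _; apply: eq_big => [l|l _];
  by rewrite !nthw.
Qed.

Lemma word_sign_enum : word_sign (enum 'I_n) = 1.
Proof.
rewrite -word_of1 word_sign_of chi_inversions big1 // => i _.
by rewrite big1 // => j; rewrite !perm1 => /andP[]; lia.
Qed.

(** [word_sign] and [G] pick up the same sign [+1] or [-1] under an adjacent
    exchange, so their product does not change under any rearrangement. *)
Lemma word_sign_perm (M : lmodType K) (G : seq 'I_n -> M) :
  (forall s1 i j s2, G (s1 ++ i :: j :: s2)
     = swap_sign (tnth d i) (tnth d j) *: G (s1 ++ j :: i :: s2)) ->
  forall s t, perm_eq s t -> word_sign s *: G s = word_sign t *: G t.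
Proof.
move=> swapG; apply: adjacent_swaps_perm => s1 i j s2.
by rewrite swapG word_sign_swap scalerA mulrAC swap_sign_sq mul1r.
Qed.

(** Skew symmetry has to be checked for adjacent exchanges only. *)
Lemma chi_perm (M : lmodType K) (G : seq 'I_n -> M) :
  (forall s1 i j s2, G (s1 ++ i :: j :: s2)
     = swap_sign (tnth d i) (tnth d j) *: G (s1 ++ j :: i :: s2)) ->
  forall p, G (word_of p) = chi K d p *: G (enum 'I_n).
Proof.
move=> swapG p; have := word_sign_perm swapG (perm_word_of p).
rewrite word_sign_enum scale1r => <-.
by rewrite -word_sign_of scalerA word_sign_sq ?word_of_uniq // scale1r.
Qed.

End Words.
End Signs.

(** * Unshuffles as subsets of the index set *)

Section Blocks.
Variable n : nat.
Implicit Types (s : 'S_n) (A : {set 'I_n}) (p : nat).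

(** Unshuffles correspond to subsets of size [p] of the index set in this way,
    see [block_inj] and [unshuffle_of_block]. *)
Definition block p s : {set 'I_n} := [set i | (s^-1%g i < p)%N].

Lemma mem_take_word p s i : (i \in take p (word_of s)) = (i \in block p s).
Proof.
have s_i : i \in word_of s by rewrite (perm_mem (perm_word_of s)) mem_enum.
rewrite in_take // inE -[in index _ _](permKV s i) /word_of.
by rewrite index_map ?index_enum_ord //; apply: perm_inj.
Qed.

Lemma perm_take_word p s : perm_eq (take p (word_of s)) (enum (block p s)).
Proof.
apply: uniq_perm; rewrite ?enum_uniq ?take_uniq ?word_of_uniq //.
by move=> i; rewrite mem_take_word mem_enum.
Qed.

Lemma perm_drop_word p s :
  perm_eq (drop p (word_of s)) (enum (~: block p s)).
Proof.
apply: uniq_perm; rewrite ?enum_uniq ?drop_uniq ?word_of_uniq //.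
move=> i; rewrite mem_enum inE -mem_take_word.
have := word_of_uniq s; rewrite -{1}[word_of s](cat_take_drop p) cat_uniq.
case/and3P=> _ /hasPn disj _; apply/idP/idP => [/disj // | not_take].
have : i \in word_of s by rewrite (perm_mem (perm_word_of s)) mem_enum.
by rewrite -{1}[word_of s](cat_take_drop p) mem_cat (negPf not_take).
Qed.

Lemma card_block p s : (p <= n)%N -> #|block p s| = p.
Proof.
move=> le_pn; rewrite cardE -(perm_size (perm_take_word p s)).
by rewrite size_takel // size_word_of.
Qed.

Lemma unshuffle_sorted p s :
  unshuffle p s = sorted (fun i j : 'I_n => i < j)%N (take p (word_of s))
               && sorted (fun i j : 'I_n => i < j)%N (drop p (word_of s)).
Proof.
have lt_trans : transitive (fun i j : 'I_n => i < j)%N.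
  by move=> i j k; apply: ltn_trans.
case: (posnP n) => [n0|n_gt0].
  have -> : word_of s = [::] by apply/nilP; rewrite /nilp size_word_of n0.
  by apply/forallP => i; have := ltn_ord i; rewrite [X in (_ < X)%N]n0.
pose i0 := Ordinal n_gt0.
have nthw (k : 'I_n) : nth i0 (word_of s) k = s k.
  by rewrite (nth_map i0) ?size_enum_ord // nth_ord_enum.
apply/forallP/andP => [unsh|[sort_take sort_drop] i].
  split; apply/(sortedP i0) => k.
    rewrite size_take_min size_word_of => lt_k.
    have [lt_kn lt_kp] : (k.+1 < n)%N /\ (k.+1 < p)%N by lia.
    rewrite !nth_take //; last exact: ltnW.
    rewrite (nthw (Ordinal (ltnW lt_kn))) (nthw (Ordinal lt_kn)).
    have /forallP/(_ (Ordinal lt_kn)) := unsh (Ordinal (ltnW lt_kn)).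
    by rewrite /= ltnSn lt_kp.
  rewrite size_drop size_word_of => lt_k.
  have lt_kn : ((p + k).+1 < n)%N by lia.
  rewrite !nth_drop addnS.
  rewrite (nthw (Ordinal (ltnW lt_kn))) (nthw (Ordinal lt_kn)).
  have /forallP/(_ (Ordinal lt_kn)) := unsh (Ordinal (ltnW lt_kn)).
  by rewrite /= ltnSn leq_addr orbT.
apply/forallP => j; apply/implyP => /andP[lt_ij /orP[lt_jp|le_pi]].
  have lt_ip := ltn_trans lt_ij lt_jp.
  rewrite -(nthw i) -(nthw j) -(nth_take i0 lt_ip) -(nth_take i0 lt_jp).
  apply: (sorted_ltn_nth lt_trans) => //; rewrite inE size_take_min size_word_of;
    have := ltn_ord i; have := ltn_ord j; lia.
have le_pj : (p <= j)%N by apply: leq_trans (ltnW lt_ij).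
rewrite -(nthw i) -(nthw j) -(subnKC le_pi) -(subnKC le_pj).
rewrite -(nth_drop p i0) -(nth_drop p i0 _ (j - p)).
apply: (sorted_ltn_nth lt_trans) => //; rewrite ?inE ?size_drop ?size_word_of;
  have := ltn_ord i; have := ltn_ord j; lia.
Qed.

Lemma word_of_inj : injective (@word_of n).
Proof.
move=> s t /eq_in_map eq_st; apply/permP => i.
by apply: eq_st; rewrite mem_enum.
Qed.

Lemma block_inj p : {in [set s | unshuffle p s] &, injective (block p)}.
Proof.
have lt_trans : transitive (fun i j : 'I_n => i < j)%N.
  by move=> i j k; apply: ltn_trans.
have lt_irr : irreflexive (fun i j : 'I_n => i < j)%N by move=> i; apply: ltnn.
move=> s t; rewrite !inE !unshuffle_sorted => /andP[ss1 ss2] /andP[st1 st2] eq_st.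
apply: word_of_inj; rewrite -[LHS](cat_take_drop p) -[RHS](cat_take_drop p).
congr (_ ++ _); apply: (irr_sorted_eq lt_trans lt_irr) => //.
  by move=> i; rewrite !mem_take_word eq_st.
move=> i; rewrite (perm_mem (perm_drop_word p s)) (perm_mem (perm_drop_word p t)).
by rewrite eq_st.
Qed.

(** The unshuffle lists the elements of [A] in increasing order, then those of
    its complement. *)
Lemma unshuffle_of_block p A : #|A| = p -> exists2 s, unshuffle p s & block p s = A.
Proof.
move=> cardA; have lt_trans : transitive (fun i j : 'I_n => i < j)%N.
  by move=> i j k; apply: ltn_trans.
have : perm_eq (enum A ++ enum (~: A)) (ord_tuple n).
  apply: uniq_perm; rewrite ?cat_uniq ?enum_uniq ?andbT //.
    by apply/hasPn => i; rewrite !mem_enum inE.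
  by move=> i; rewrite mem_cat !mem_enum inE orbN.
case/tuple_permP => s word_s.
have {}word_s : word_of s = enum A ++ enum (~: A).
  by rewrite word_s /word_of; apply: eq_map => i; rewrite tnth_ord_tuple.
have sizeA : size (enum A) = p by rewrite -cardE.
have enum_sorted B : sorted (fun i j : 'I_n => i < j)%N (enum B).
  rewrite {1}/enum_mem sorted_filter // -enumT.
  have -> : sorted (fun i j : 'I_n => i < j)%N (enum 'I_n) = sorted ltn (map val (enum 'I_n)).
    by rewrite sorted_map.
  by rewrite val_enum_ord iota_ltn_sorted.
exists s; last first.
  by apply/setP => i; rewrite -mem_take_word word_s take_size_cat // mem_enum.
by rewrite unshuffle_sorted word_s take_size_cat ?drop_size_cat ?enum_sorted.
Qed.

(** A sum over subsets of fixed size can be reindexed by any permutation of the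
    index set, which is not possible for the sum over unshuffles. *)
Lemma sum_over_blocks (K : nmodType) p (H : {set 'I_n} -> K) : (p <= n)%N ->
  \sum_(s | unshuffle p s) H (block p s) = \sum_(A : {set 'I_n} | #|A| == p) H A.
Proof.
move=> le_pn; transitivity (\sum_(A in block p @: [set s | unshuffle p s]) H A).
  by rewrite big_imset; [apply: eq_bigl => s; rewrite inE | apply: block_inj].
apply: eq_bigl => A; apply/imsetP/eqP => [[s _ ->]|/unshuffle_of_block[s unsh_s <-]].
  exact: card_block.
by exists s; rewrite ?inE.
Qed.
End Blocks.

Section Cancellation.
Variables (K : fieldType) (n : nat) (d : n.-tuple int) (F G : seq 'I_n -> K).
Hypothesis two_neq0 : (2 : K) != 0.
Hypothesis swapF : forall s1 i j s2, F (s1 ++ i :: j :: s2)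
  = swap_sign K (tnth d i) (tnth d j) * F (s1 ++ j :: i :: s2).
Hypothesis swapG : forall s1 i j s2, G (s1 ++ i :: j :: s2)
  = swap_sign K (tnth d i) (tnth d j) * G (s1 ++ j :: i :: s2).

Let Phi s1 s2 := word_sign K d (s1 ++ s2) * (F s1 * G s2).

(** The sign [word_sign] compensates the skew symmetry of [F] and of [G]: the
    term attached to a splitting of the index set depends only on the two
    blocks as sets. *)
Lemma block_terms_perm s1 t1 s2 t2 :
  perm_eq s1 t1 -> perm_eq s2 t2 -> Phi s1 s2 = Phi t1 t2.
Proof.
move=> st1 st2; transitivity (Phi t1 s2).
  move: st1; apply: (adjacent_swaps_perm (F := Phi^~ s2)) => r1 i j r2.
  rewrite /Phi -!catA /= word_sign_swap swapF.
  by rewrite -[RHS]mul1r -(swap_sign_sq K (tnth d i) (tnth d j)); ring.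
move: st2; apply: (adjacent_swaps_perm (F := Phi t1)) => r1 i j r2.
rewrite /Phi !catA word_sign_swap swapG.
by rewrite -[RHS]mul1r -(swap_sign_sq K (tnth d i) (tnth d j)); ring.
Qed.

Variables (i j : 'I_n).
Hypotheses (neq_ij : i != j) (di : tnth d i = 0) (dj : tnth d j = 0).
Hypothesis Ft : forall s, F (map (tperm i j) s) = F s.
Hypothesis Gt : forall s, G (map (tperm i j) s) = G s.

Let t := tperm i j.

Lemma degree_tperm k : tnth d (t k) = tnth d k.
Proof. by rewrite /t; case: tpermP => [->|->|//]; rewrite di dj. Qed.

(** Elements of degree zero contribute nothing to the Koszul sign, and every
    inversion of a transposition involves one of the exchanged indices. *)
Lemma chi_tperm : chi K d t = -1.
Proof.
rewrite /chi odd_tperm neq_ij expr1 /koszul big1 ?mulr1 // => k _.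
rewrite big1 // => l /andP[lt_kl lt_t]; rewrite !degree_tperm.
have [->|k_i] := eqVneq k i; first by rewrite di mul0r.
have [->|k_j] := eqVneq k j; first by rewrite dj mul0r.
have [->|l_i] := eqVneq l i; first by rewrite di mulr0.
have [->|l_j] := eqVneq l j; first by rewrite dj mulr0.
by move: lt_t; rewrite /t !tpermD 1?eq_sym // ltnNge ltnW.
Qed.

Lemma word_sign_tperm s : perm_eq s (enum 'I_n) ->
  word_sign K d (map t s) = - word_sign K d s.
Proof.
move=> s_enum; have swap_t s1 k l s2 :
    word_sign K d (map t (s1 ++ k :: l :: s2)) = swap_sign K (tnth d k) (tnth d l)
      *: (word_sign K d (map t (s1 ++ l :: k :: s2)) : K^o).
  by rewrite !map_cat /= word_sign_swap !degree_tperm.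
have := @word_sign_perm K n d K^o (fun s => word_sign K d (map t s)) swap_t _ _ s_enum.
rewrite word_sign_enum scale1r -/(word_of t) word_sign_of chi_tperm.
have s_uniq : uniq s by rewrite (perm_uniq s_enum) enum_uniq.
have := word_sign_sq K d s_uniq; set q := word_sign K d s => q2 eq_q.
have {}eq_q : q * word_sign K d (map t s) = -1 := eq_q.
by rewrite -[LHS]mul1r -q2 -mulrA eq_q mulrN1.
Qed.

(** When two entries of degree zero are equal, exchanging them keeps [F] and [G]
    and reverses the sign. The exchange permutes the blocks of size [p], so the
    sum is its own opposite. *)
Lemma unshuffle_sum_cancel p : (p <= n)%N ->
  \sum_(s : 'S_n | unshuffle p s)
     chi K d s * (F (take p (word_of s)) * G (drop p (word_of s))) = 0.
Proof.
move=> le_pn; pose H (A : {set 'I_n}) := Phi (enum A) (enum (~: A)).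
have eq_H s : chi K d s * (F (take p (word_of s)) * G (drop p (word_of s)))
    = H (block p s).
  rewrite /H -(block_terms_perm (perm_take_word p s) (perm_drop_word p s)) /Phi.
  by rewrite cat_take_drop word_sign_of.
rewrite (eq_bigr _ (fun s _ => eq_H s)) sum_over_blocks //.
have Ht (A : {set 'I_n}) : H (t @: A) = - H A.
  have im_perm (B : {set 'I_n}) : perm_eq (enum (t @: B)) (map t (enum B)).
    apply: uniq_perm; rewrite ?enum_uniq ?map_inj_uniq ?enum_uniq //; first exact: perm_inj.
    move=> k; rewrite mem_enum; apply/imsetP/mapP => -[l lB ->]; exists l => //.
      by rewrite mem_enum.
    by rewrite mem_enum in lB.
  have im_permC : perm_eq (enum (~: (t @: A))) (map t (enum (~: A))).
    suff -> : ~: (t @: A) = t @: (~: A) by [].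
    apply/setP => k; rewrite inE -[k](permKV t) !mem_imset ?inE //; exact: perm_inj.
  rewrite /H (block_terms_perm (im_perm A) im_permC) /Phi -map_cat Ft Gt.
  rewrite word_sign_tperm ?mulNr //; apply: uniq_perm; rewrite ?cat_uniq ?enum_uniq ?andbT //.
    by apply/hasPn => k; rewrite !mem_enum inE.
  by move=> k; rewrite mem_cat !mem_enum !inE orbN.
set S := \sum_(A | _) _; have S_opp : S = - S.
  rewrite /S -sumrN [LHS](reindex_inj (imset_inj (@perm_inj _ t))).
  apply: eq_big => [A|A _]; last exact: Ht.
  by rewrite card_imset //; apply: perm_inj.
have : S * 2 = 0 by rewrite mulr_natr mulr2n {1}S_opp addNr.
by move/eqP; rewrite mulf_eq0 (negPf two_neq0) orbF => /eqP.
Qed.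
End Cancellation.

(** * The explicit operators *)

Section Operators.
Variables (K : fieldType) (V : vectType K).
Implicit Types (l : operators V) (s t : seq V).

Lemma apply_tuple l n (x : n.-tuple V) : apply l x = l n x.
Proof.
case: x => s size_s; have := size_s => /eqP eq_n; case: _ / eq_n size_s => size_s.
by congr (l _ _); apply: val_inj.
Qed.

Lemma multilinearZ l k s1 y s2 : multilinear l ->
  apply l (s1 ++ k *: y :: s2) = k *: apply l (s1 ++ y :: s2).
Proof.
move=> lin_l; have l0 : apply l (s1 ++ 0 :: s2) = 0.
  have := lin_l s1 s2 1 0 0; rewrite !scale1r addr0 => /eqP.
  by rewrite -subr_eq0 opprD addNKr oppr_eq0 => /eqP.
by rewrite -[k *: y]addr0 lin_l l0 addr0.
Qed.

Lemma rearrange_word n (x : n.-tuple V) p :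
  rearrange x p = [seq tnth x i | i <- word_of p] :> seq V.
Proof. by rewrite /rearrange /word_of -map_comp. Qed.

(** For skew symmetric operators one ordering of the arguments decides all. *)
Lemma skew_agree gr l1 l2 n (d : n.-tuple int) (t : n.-tuple V) s :
    skew_symmetric gr l1 -> skew_symmetric gr l2 -> (0 < n)%N ->
    homogeneous gr d t -> l1 n t = l2 n t -> perm_eq s t ->
  apply l1 s = apply l2 s.
Proof.
move=> skew1 skew2 n_gt0 hom_t eq_t /tuple_permP[p ->].
by rewrite !apply_tuple (skew1 _ _ _ _ _ hom_t) // (skew2 _ _ _ _ _ hom_t) ?eq_t.
Qed.
End Operators.

Section ThreeLines.
Variables (K : fieldType) (V : vectType K) (gr : int -> {vspace V}).
Variables (u v w : V).
Hypotheses (hsum : (gr (-1)%R + gr 0%R + gr 1%R)%VS = fullv)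
  (hdirect : directv (gr (-1)%R + gr 0%R + gr 1%R)%VS)
  (hother : forall d : int, d \notin [:: -1; 0; 1] -> gr d = 0%VS)
  (hu : u != 0) (hv : v != 0) (hw : w != 0)
  (hgru : gr (-1) = <[u]>%VS) (hgrv : gr 0 = <[v]>%VS)
  (hgrw : gr 1 = <[w]>%VS).

Definition cu (x : V) : K := coord [tuple u; v; w] 0 x.
Definition cv (x : V) : K := coord [tuple u; v; w] 1 x.
Definition cw (x : V) : K := coord [tuple u; v; w] 2 x.

Lemma span_uvw : <<[:: u; v; w]>>%VS = fullv.
Proof. by rewrite !span_cons span_nil addv0 addvA -hgru -hgrv -hgrw hsum. Qed.

Lemma free_uvw : free [:: u; v; w].
Proof.
rewrite /free span_uvw -hsum (directvP hdirect) /=.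
by rewrite hgru hgrv hgrw !dim_vline hu hv hw.
Qed.

Lemma cu_lin k y z : cu (k *: y + z) = k * cu y + cu z.
Proof. exact: linearP. Qed.
Lemma cv_lin k y z : cv (k *: y + z) = k * cv y + cv z.
Proof. exact: linearP. Qed.
Lemma cw_lin k y z : cw (k *: y + z) = k * cw y + cw z.
Proof. exact: linearP. Qed.

Lemma coord_basis (i j : 'I_3) :
  coord [tuple u; v; w] i [:: u; v; w]`_j = (j == i)%:R.
Proof. exact: (@coord_free _ _ _ [tuple u; v; w] j i free_uvw). Qed.

Lemma cu_basis : [/\ cu u = 1, cu v = 0 & cu w = 0].
Proof.
by split; [apply: (coord_basis 0 0) | apply: (coord_basis 0 1)
  | apply: (coord_basis 0 2)].
Qed.
Lemma cv_basis : [/\ cv u = 0, cv v = 1 & cv w = 0].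
Proof.
by split; [apply: (coord_basis 1 0) | apply: (coord_basis 1 1)
  | apply: (coord_basis 1 2)].
Qed.
Lemma cw_basis : [/\ cw u = 0, cw v = 0 & cw w = 1].
Proof.
by split; [apply: (coord_basis 2 0) | apply: (coord_basis 2 1)
  | apply: (coord_basis 2 2)].
Qed.

Lemma coords_sum x : x = cu x *: u + (cv x *: v + (cw x *: w + 0)).
Proof.
have : x \in <<[tuple u; v; w]>>%VS by rewrite span_uvw memvf.
move/coord_span => def_x; rewrite [LHS]def_x !big_ord_recl big_ord0 /=.
have -> : lift ord0 (lift ord0 ord0) = 2 :> 'I_3 by apply: val_inj.
by have -> : lift ord0 ord0 = 1 :> 'I_3 by apply: val_inj.
Qed.

Lemma coords_comb (x y z : K) (s := x *: u + y *: v + z *: w) :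
  [/\ cu s = x, cv s = y & cw s = z].
Proof.
have [uu vu wu] := cu_basis; have [uv vv wv] := cv_basis.
have [uw vw ww] := cw_basis.
by split; rewrite /s /cu /cv /cw !linearD !linearZ /= -?/(cu _) -?/(cv _) -?/(cw _)
  ?uu ?uv ?uw ?vu ?vv ?vw ?wu ?wv ?ww !(mulr0, mulr1, addr0, add0r).
Qed.

Lemma coordZ (k : K) x : [/\ cu (k *: x) = k * cu x, cv (k *: x) = k * cv x
  & cw (k *: x) = k * cw x].
Proof. by split; apply: linearZ. Qed.

Lemma coord_degree d x : x \in gr d ->
  [/\ d != -1 -> cu x = 0, d != 0 -> cv x = 0 & d != 1 -> cw x = 0].
Proof.
have [uu vu wu] := cu_basis; have [uv vv wv] := cv_basis.
have [uw vw ww] := cw_basis.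
have [->|d_u] := eqVneq d (-1).
  by rewrite hgru => /vlineP[k ->]; have [-> -> ->] := coordZ k u;
     rewrite uv uw !mulr0.
have [->|d_v] := eqVneq d 0.
  by rewrite hgrv => /vlineP[k ->]; have [-> -> ->] := coordZ k v;
     rewrite vu vw !mulr0.
have [->|d_w] := eqVneq d 1.
  by rewrite hgrw => /vlineP[k ->]; have [-> -> ->] := coordZ k w;
     rewrite wu wv !mulr0.
rewrite hother ?inE ?negb_or ?d_u ?d_v ?d_w // memv0 => /eqP ->.
by have [] := coordZ 0 0; rewrite scale0r !mul0r => -> -> ->.
Qed.

(** Let [u], [v], [w] generate an associative algebra in which [u] and [w]
    commute, [v] anticommutes with both, and the square of [v] is zero. The next
    four functions are the coefficients of the monomials w^n, u w^(n-1),
    v w^(n-1) and u v w^(n-2) in the product of a list of n vectors; the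
    recursive clauses multiply by the first vector on the left, and the minus
    signs come from moving it past [v], or [v] past [u]. *)
Fixpoint cW (s : seq V) : K := if s is x :: s' then cw x * cW s' else 1.

Fixpoint cUW s := if s is x :: s' then cu x * cW s' + cw x * cUW s' else 0.

Fixpoint cVW s := if s is x :: s' then cv x * cW s' - cw x * cVW s' else 0.

Fixpoint cUVW s :=
  if s is x :: s' then cu x * cVW s' - cv x * cUW s' - cw x * cUVW s' else 0.

Lemma coefs_lin s1 k y z s2 :
  [/\ cW (s1 ++ (k *: y + z) :: s2) = k * cW (s1 ++ y :: s2) + cW (s1 ++ z :: s2),
      cUW (s1 ++ (k *: y + z) :: s2) = k * cUW (s1 ++ y :: s2) + cUW (s1 ++ z :: s2),
      cVW (s1 ++ (k *: y + z) :: s2) = k * cVW (s1 ++ y :: s2) + cVW (s1 ++ z :: s2)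
    & cUVW (s1 ++ (k *: y + z) :: s2)
        = k * cUVW (s1 ++ y :: s2) + cUVW (s1 ++ z :: s2)].
Proof.
elim: s1 => [|x s1 [IHw IHu IHv IHuv]] /=.
  by rewrite cu_lin cv_lin cw_lin; split; ring.
by rewrite IHw IHu IHv IHuv; split; ring.
Qed.

(** Homogeneous vectors of odd degree are combinations of [u] and [w], hence
    commute in the algebra above; those of even degree are multiples of [v],
    hence anticommute with all homogeneous vectors. *)
Lemma coefs_swap d e x y s1 s2 : x \in gr d -> y \in gr e ->
  [/\ cW (s1 ++ x :: y :: s2) = swap_sign K d e * cW (s1 ++ y :: x :: s2),
      cUW (s1 ++ x :: y :: s2) = swap_sign K d e * cUW (s1 ++ y :: x :: s2),
      cVW (s1 ++ x :: y :: s2) = swap_sign K d e * cVW (s1 ++ y :: x :: s2)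
    & cUVW (s1 ++ x :: y :: s2) = swap_sign K d e * cUVW (s1 ++ y :: x :: s2)].
Proof.
move=> x_d y_e; have parity f z : z \in gr f ->
    if oddz f then cv z = 0 else cu z = 0 /\ cw z = 0.
  move=> /coord_degree[u0 v0 w0]; case: ifP => f_odd; first apply: v0.
    by apply: contraTneq f_odd => ->.
  by split; [apply: u0 | apply: w0]; apply: contraFneq f_odd => ->.
elim: s1 => [|z s1 [IHw IHu IHv IHuv]] /=; last first.
  by rewrite IHw IHu IHv IHuv; split; ring.
move: (parity _ _ x_d) (parity _ _ y_e); rewrite /swap_sign.
by case: (oddz d) => [->|[-> ->]]; case: (oddz e) => [->|[-> ->]]; split; rewrite /=; ring.
Qed.

Section Operator.
Variables (a b c : nat -> K).

(** The only possible operators: the product in the algebra above, followed by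
    a linear map that depends on the number of factors. *)
Definition explicit n (s : seq V) : V :=
  a n * cUVW s *: u + b n * cUW s *: v + c n * cVW s *: w.

Definition explicit_ops : operators V := fun n x => explicit n x.

Lemma apply_explicit s : apply explicit_ops s = explicit (size s) s.
Proof. by []. Qed.

Lemma cu_explicit n s : cu (explicit n s) = a n * cUVW s.
Proof. by case: (coords_comb (a n * cUVW s) (b n * cUW s) (c n * cVW s)). Qed.

Lemma cv_explicit n s : cv (explicit n s) = b n * cUW s.
Proof. by case: (coords_comb (a n * cUVW s) (b n * cUW s) (c n * cVW s)). Qed.

Lemma cw_explicit n s : cw (explicit n s) = c n * cVW s.
Proof. by case: (coords_comb (a n * cUVW s) (b n * cUW s) (c n * cVW s)). Qed.

Lemma explicit_multilinear : multilinear explicit_ops.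
Proof.
move=> s1 s2 k y z; rewrite !apply_explicit !size_cat /= /explicit.
have [_ -> -> ->] := coefs_lin s1 k y z s2.
rewrite !mulrDr !scalerDl !scalerDr !scalerA.
set p := (_ + _)%N; rewrite !(mulrCA k).
by rewrite -[RHS]addrACA; congr (_ + _); rewrite -[RHS]addrACA.
Qed.

Lemma explicit_swap n d e x y s1 s2 : x \in gr d -> y \in gr e ->
  explicit n (s1 ++ x :: y :: s2)
    = swap_sign K d e *: explicit n (s1 ++ y :: x :: s2).
Proof.
move=> x_d y_e; rewrite /explicit.
have [_ -> -> ->] := coefs_swap s1 s2 x_d y_e.
by rewrite !scalerDr !scalerA !(mulrCA (swap_sign _ _ _)).
Qed.

Lemma explicit_skew : skew_symmetric gr explicit_ops.
Proof.
move=> n d x p _ hom_x.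
pose G s := explicit n [seq tnth x i | i <- s].
have swapG s1 i j s2 : G (s1 ++ i :: j :: s2)
    = swap_sign K (tnth d i) (tnth d j) *: G (s1 ++ j :: i :: s2).
  by rewrite /G !map_cat /=; apply: explicit_swap; apply: hom_x.
by rewrite /explicit_ops rearrange_word [LHS](chi_perm swapG p) /G map_tnth_enum.
Qed.

(** Together with the degrees of [u], [v] and [w] this shows that [explicit n] has
    degree [2 - n]. *)
Lemma coefs_degree ds s : all2 (fun d x => x \in gr d) ds s ->
  let D := \sum_(d <- ds) d in
  [/\ cW s != 0 -> D = (size s)%:Z, cUW s != 0 -> D = (size s)%:Z - 2,
      cVW s != 0 -> D = (size s)%:Z - 1 & cUVW s != 0 -> D = (size s)%:Z - 3].
Proof.
elim: ds s => [|d ds IHds] [|x s] //=.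
  by rewrite big_nil eqxx; split.
case/andP=> /coord_degree[xu xv xw] /IHds[IHw IHu IHv IHuv].
rewrite big_cons; have add_neq0 (p q : K) : p + q != 0 -> p != 0 \/ q != 0.
  by case: (eqVneq p 0) => [->|]; [rewrite add0r; right | left].
have u_d : cu x != 0 -> d = -1 by apply: contraNeq => /xu ->.
have v_d : cv x != 0 -> d = 0 by apply: contraNeq => /xv ->.
have w_d : cw x != 0 -> d = 1 by apply: contraNeq => /xw ->.
split.
- by rewrite mulf_eq0 negb_or => /andP[/w_d -> /IHw ->]; rewrite intS; ring.
- by case/add_neq0; rewrite mulf_eq0 negb_or => /andP[];
    [move/u_d => -> /IHw -> | move/w_d => -> /IHu ->]; rewrite intS; ring.
- by case/add_neq0; rewrite ?oppr_eq0 mulf_eq0 negb_or => /andP[];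
    [move/v_d => -> /IHw -> | move/w_d => -> /IHv ->]; rewrite intS; ring.
case/add_neq0 => [/add_neq0[]|]; rewrite ?oppr_eq0 mulf_eq0 negb_or => /andP[].
- by move/u_d => -> /IHv ->; rewrite intS; ring.
- by move/v_d => -> /IHu ->; rewrite intS; ring.
- by move/w_d => -> /IHuv ->; rewrite intS; ring.
Qed.

Lemma explicit_degree : degree_2_minus_n gr explicit_ops.
Proof.
move=> n d x n_gt0 hom_x; rewrite -(big_tuple _ _ d predT id).
have : all2 (fun d x => x \in gr d) d x.
  rewrite all2E !size_tuple eqxx; apply/(all_nthP (0, 0)) => i.
  rewrite size_zip !size_tuple minnn => lt_in.
  rewrite nth_zip ?size_tuple //=.
  by have := hom_x (Ordinal lt_in); rewrite !(tnth_nth 0).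
case/coefs_degree; rewrite size_tuple => _ Du Dv Duv.
rewrite /explicit_ops /explicit.
have term k q z e : (q != 0 -> 2%:Z - n%:Z + \sum_(d0 <- d) d0 = e) ->
    z \in gr e -> k * q *: z \in gr (2%:Z - n%:Z + \sum_(d0 <- d) d0).
  move=> De z_e; have [->|/De ->] := eqVneq q 0.
    by rewrite mulr0 scale0r mem0v.
  exact: memvZ.
rewrite !memvD // ; [apply: (term _ _ _ (-1)) | apply: (term _ _ _ 0)
  | apply: (term _ _ _ 1)]; rewrite ?hgru ?hgrv ?hgrw ?memv_line //.
- by move/Duv ->; ring.
- by move/Du ->; ring.
- by move/Dv ->; ring.
Qed.

Lemma explicit_graded : graded_operators gr explicit_ops.
Proof.
split; [exact: explicit_multilinear | exact: explicit_skew
  | exact: explicit_degree].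
Qed.

Lemma coefs_w m : [/\ cW (nseq m w) = 1, cUW (nseq m w) = 0,
  cVW (nseq m w) = 0 & cUVW (nseq m w) = 0].
Proof.
have [_ _ uw] := cu_basis; have [_ _ vw] := cv_basis.
have [_ _ ww] := cw_basis.
elim: m => [|m [IHw IHu IHv IHuv]] //=.
by rewrite IHw IHu IHv IHuv uw vw ww; split; ring.
Qed.

(** This gives the vanishing of [explicit] on all words in the basis other than
    the rearrangements of the three listed ones. *)
Lemma coefs_word s : {subset s <= [:: u; v; w]} ->
  [/\ cW s != 0 -> s = nseq (size s) w,
      cUW s != 0 -> perm_eq s (u :: nseq (size s - 1) w),
      cVW s != 0 -> perm_eq s (v :: nseq (size s - 1) w)
    & cUVW s != 0 -> (1 < size s)%N /\ perm_eq s [:: u, v & nseq (size s - 2) w]].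
Proof.
have [uu vu wu] := cu_basis; have [uv vv wv] := cv_basis.
have [uw vw ww] := cw_basis.
elim: s => [|x s IHs] sub; first by rewrite /= eqxx.
have /IHs[IHw IHu IHv IHuv] : {subset s <= [:: u; v; w]}.
  by move=> y sy; rewrite sub // inE sy orbT.
have perm_cons2 y z t : perm_eq s (y :: t) -> perm_eq (z :: s) (y :: z :: t).
  move=> st; rewrite -[y :: z :: t]/([:: y] ++ [:: z] ++ t) perm_sym.
  by rewrite perm_catCA /= perm_cons perm_sym.
have size1 y t : perm_eq s (y :: t) -> (size s - 1).+1 = size s.
  by move/perm_size => /= ->; rewrite subn1.
rewrite /= !subSS subn0; have := sub x (mem_head _ _); rewrite !inE.
case/or3P => /eqP ->; rewrite ?uu ?uv ?uw ?vu ?vv ?vw ?wu ?wv ?ww;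
  rewrite ?mul0r ?mul1r ?subr0 ?add0r ?addr0 ?sub0r ?oppr_eq0 ?eqxx;
  split=> // nz.
- by rewrite perm_cons -IHw.
- have sv := IHv nz; split; last by rewrite perm_cons.
  by rewrite ltnS -(size1 _ _ sv).
- by rewrite perm_cons -IHw.
- have su := IHu nz; split; first by rewrite ltnS -(size1 _ _ su).
  exact: perm_cons2.
- by rewrite -IHw.
- have su := IHu nz; rewrite -(size1 _ _ su) /=; exact: perm_cons2.
- have sv := IHv nz; rewrite -(size1 _ _ sv) /=; exact: perm_cons2.
have [size_s suv] := IHuv nz; split; first exact: ltnW.
case: (size s) size_s suv => [|[|m]] // _; rewrite !subSS subn0 => suv.
rewrite -[nseq _ _]/(w :: nseq m w) -[[:: u, v & _]]/([:: u; v] ++ [:: w] ++ nseq m w).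
by rewrite perm_sym perm_catCA /= perm_cons perm_sym.
Qed.

Lemma explicit_given : given_by_constants u v w a b c explicit_ops.
Proof.
have [uu vu wu] := cu_basis; have [uv vv wv] := cv_basis.
have [uw vw ww] := cw_basis.
split=> [n n_ge2|n n_ge1|n n_ge1|s s_ge1 sub nuvw nuw nvw];
  rewrite apply_explicit /explicit /=.
- rewrite size_nseq -addn2 subnK //; have [-> -> -> ->] := coefs_w (n - 2).
  rewrite uu uv uw vu vv vw !(mulr0, mul0r, mulr1, subr0, addr0, scale0r, oppr0).
  by [].
- rewrite size_nseq -addn1 subnK //; have [-> -> -> ->] := coefs_w (n - 1).
  by rewrite uu uv uw !(mulr0, mul0r, mulr1, subr0, addr0, add0r, scale0r, oppr0).
- rewrite size_nseq -addn1 subnK //; have [-> -> -> ->] := coefs_w (n - 1).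
  by rewrite vu vv vw !(mulr0, mul0r, mulr1, subr0, addr0, add0r, scale0r, oppr0).
have [_ Eu Ev Euv] := coefs_word sub.
have -> : cUVW s = 0 by apply: contraNeq nuvw => /Euv[-> ->].
have -> : cUW s = 0 by apply: contraNeq nuw => /Eu ->.
have -> : cVW s = 0 by apply: contraNeq nvw => /Ev ->.
by rewrite !mulr0 !scale0r !addr0.
Qed.

Lemma graded_given_word_unique l s :
    graded_operators gr l -> given_by_constants u v w a b c l ->
    (0 < size s)%N -> {subset s <= [:: u; v; w]} ->
  apply l s = explicit (size s) s.
Proof.
move=> [_ skew_l _] [la lb lc l0] s_gt0 sub.
have [ea eb ec e0] := explicit_given.
pose deg x : int := if x == u then -1 else if x == v then 0 else 1.
have agree t : perm_eq s t -> apply l t = apply explicit_ops t ->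
    apply l s = explicit (size s) s.
  move=> st eq_t; rewrite -apply_explicit.
  apply: (@skew_agree K V gr l explicit_ops _ (map_tuple deg (in_tuple t)) (in_tuple t)) => //.
  - exact: explicit_skew.
  - by rewrite -(perm_size st).
  move=> i; rewrite tnth_map /deg.
  have : tnth (in_tuple t) i \in [:: u; v; w].
    by apply: sub; rewrite (perm_mem st) mem_tnth.
  rewrite !inE; case: eqP => [->|_]; first by rewrite hgru memv_line.
  case: eqP => [->|_]; first by rewrite hgrv memv_line.
  by case: eqP => // ->; rewrite hgrw memv_line.
have [/andP[s_ge2 /agree ->//]|nuvw] :=
    boolP ((2 <= size s)%N && perm_eq s [:: u, v & nseq (size s - 2) w]).
  by rewrite la // ea.
have [/agree ->//|nuw] := boolP (perm_eq s (u :: nseq (size s - 1) w)).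
  by rewrite lb // eb.
have [/agree ->//|nvw] := boolP (perm_eq s (v :: nseq (size s - 1) w)).
  by rewrite lc // ec.
by rewrite l0 // -apply_explicit e0.
Qed.

(** By multilinearity the values on words in the basis determine the operators,
    and by skew symmetry these follow from the constants. Hence everything can be
    computed with the explicit operators. *)
Lemma graded_given_unique l s :
    graded_operators gr l -> given_by_constants u v w a b c l ->
    (0 < size s)%N ->
  apply l s = explicit (size s) s.
Proof.
move=> graded_l given_l.
have lin_l : multilinear l by case: graded_l.
have lin_e := explicit_multilinear.
suff gen s2 s1 : {subset s1 <= [:: u; v; w]} -> (0 < size (s1 ++ s2))%N ->
    apply l (s1 ++ s2) = apply explicit_ops (s1 ++ s2).
  by move=> s_gt0; apply: (gen s [::]).
elim: s2 s1 => [|x s2 IHs2] s1 sub s_gt0.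
  by rewrite cats0 in s_gt0 *; apply: graded_given_word_unique.
rewrite (coords_sum x) !lin_l !lin_e.
have letter y : y \in [:: u; v; w] ->
    apply l (s1 ++ y :: s2) = apply explicit_ops (s1 ++ y :: s2).
  move=> y_uvw; rewrite -cat_rcons IHs2 //.
    by move=> z; rewrite mem_rcons inE => /orP[/eqP -> | /sub].
  by rewrite size_cat size_rcons addSn.
have zero l' : multilinear l' -> apply l' (s1 ++ 0 :: s2) = 0.
  by move=> lin; rewrite -(scale0r w) multilinearZ // !scale0r.
rewrite (zero _ lin_l) (zero _ lin_e) (letter u) ?(letter v) ?(letter w) //;
  by rewrite !inE eqxx ?orbT.
Qed.

End Operator.

(** * The Jacobi sums *)

(** The convolution of two functions of lists: a signed sum over all ways to cut
    [x] into two blocks, the first of size [p]. *)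
Definition split_sum n (d : n.-tuple int) (x : n.-tuple V) (F G : seq V -> K) p :=
  \sum_(s : 'S_n | unshuffle p s) chi K d s *
    (F [seq tnth x i | i <- take p (word_of s)]
      * G [seq tnth x i | i <- drop p (word_of s)]).

(** The inner value enters the outer operator only through its three
    coordinates, which are coefficients of the first block; multiplied on the
    left, each of them picks out one coefficient of the second block. *)
Lemma jacobi_formula a b c l n (d : n.-tuple int) (x : n.-tuple V)
    (S := split_sum d x) :
    graded_operators gr l -> given_by_constants u v w a b c l ->
  jacobi l d x =
    (\sum_(1 <= p < n.+1) (-1) ^+ (p * (n - p)) * (a (n - p).+1 *
      (a p * S cUVW cVW p - b p * S cUW cUW p - c p * S cVW cUVW p))) *: u
    + (\sum_(1 <= p < n.+1) (-1) ^+ (p * (n - p)) * (b (n - p).+1 *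
      (a p * S cUVW cW p + c p * S cVW cUW p))) *: v
    + (\sum_(1 <= p < n.+1) (-1) ^+ (p * (n - p)) * (c (n - p).+1 *
      (b p * S cUW cW p - c p * S cVW cVW p))) *: w.
Proof.
move=> graded_l given_l; rewrite !scaler_suml -!big_split /=.
apply: eq_big_nat => p /andP[p_gt0 le_pn].
rewrite -!scalerA -!scalerDr; congr (_ *: _).
rewrite /S /split_sum !mulr_sumr -!sumrB -!big_split /=.
rewrite !scaler_suml !scaler_sumr.
rewrite -!big_split /=; apply: eq_bigr => s _.
rewrite rearrange_word -map_take -map_drop.
set s1 := map _ (take _ _); set s2 := map _ (drop _ _).
have size1 : size s1 = p by rewrite size_map size_takel // size_word_of.
have size2 : size s2 = (n - p)%N by rewrite size_map size_drop size_word_of.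
rewrite !(graded_given_unique graded_l given_l) ?size1 //= size2.
rewrite /(explicit _ _ _ (n - p).+1 _) /= cu_explicit cv_explicit cw_explicit.
rewrite !scalerDr !scalerA; congr (_ *: _ + _ *: _ + _ *: _); ring.
Qed.

Lemma coefs_scale (I : Type) (k : I -> K) (e : I -> V) (s : seq I)
    (ke := fun i => k i *: e i) :
  [/\ cW (map ke s) = (\prod_(i <- s) k i) * cW (map e s),
      cUW (map ke s) = (\prod_(i <- s) k i) * cUW (map e s),
      cVW (map ke s) = (\prod_(i <- s) k i) * cVW (map e s)
    & cUVW (map ke s) = (\prod_(i <- s) k i) * cUVW (map e s)].
Proof.
elim: s => [|i s [IHw IHu IHv IHuv]] /=; first by rewrite big_nil; split; ring.
have [-> -> ->] := coordZ (k i) (e i).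
by rewrite IHw IHu IHv IHuv big_cons; split; ring.
Qed.

Lemma coefs_no_v s : all (fun x => cv x == 0) s -> cVW s = 0 /\ cUVW s = 0.
Proof.
elim: s => //= x s IHs /andP[/eqP -> /IHs[-> ->]].
by split; ring.
Qed.

(** The coefficients of the two monomials that contain [v], treated alike in the
    cancellation of terms. *)
Definition coefV (f : bool) := if f then cUVW else cVW.

(** Both factors need an entry with a component along [v]. If two entries have
    one, both are multiples of [v]; once the scalars are pulled out, the two
    entries are equal and the sum cancels. Otherwise every term is zero. *)
Lemma split_sum_coefV n (d : n.-tuple int) (x : n.-tuple V) f g p :
    (2 : K) != 0 -> homogeneous gr d x -> (p <= n)%N ->
  split_sum d x (coefV f) (coefV g) p = 0.
Proof.
move=> two_neq0 hom_x le_pn.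
have has_v h s : coefV h (map (tnth x) s) != 0 ->
    exists2 i, i \in s & cv (tnth x i) != 0.
  move=> nz; apply/hasP; apply: contraNT nz => no_v.
  have /coefs_no_v[v0 uv0] : all (fun y => cv y == 0) (map (tnth x) s).
    rewrite all_map; apply/allP => i si; apply: contraNT no_v => cv_i.
    by apply/hasP; exists i.
  by case: h => /=; rewrite ?v0 ?uv0.
have [[i j] /= /and3P[neq_ij vi vj]|no_pair] := pickP
  (fun ij : 'I_n * 'I_n =>
    [&& ij.1 != ij.2, cv (tnth x ij.1) != 0 & cv (tnth x ij.2) != 0]); last first.
  (* Without such a pair, the two blocks cannot both contain an entry with a
     component along v. *)
  rewrite /split_sum big1 // => s _.
  have [->|/has_v[i si vi]] :=
    eqVneq (coefV f [seq tnth x i | i <- take p (word_of s)]) 0.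
    by rewrite mul0r mulr0.
  have [->|/has_v[j sj vj]] :=
    eqVneq (coefV g [seq tnth x i | i <- drop p (word_of s)]) 0.
    by rewrite !mulr0.
  have := no_pair (i, j); rewrite /= vi vj !andbT => /negbFE/eqP eq_ij.
  have := word_of_uniq s; rewrite -[word_of s](cat_take_drop p) cat_uniq.
  by case/and3P=> _ /hasPn disj _; have := disj _ sj; rewrite -eq_ij /= si.
have v_degree k : cv (tnth x k) != 0 -> tnth d k = 0.
  by have [_ v0 _] := coord_degree (hom_x k); apply: contraNeq => /v0 ->.
(* With every entry that has a component along v replaced by v itself, the
   entries i and j become equal; the components turn into scalar factors. *)
pose k l := if cv (tnth x l) != 0 then cv (tnth x l) else 1.
pose e l := if cv (tnth x l) != 0 then v else tnth x l.
have xE l : tnth x l = k l *: e l.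
  rewrite /k /e; case: ifP => [v_l|_]; last by rewrite scale1r.
  have := hom_x l; rewrite v_degree // hgrv => /vlineP[z ->].
  by have [_ -> _] := coordZ z v; have [_ -> _] := cv_basis; rewrite mulr1.
have e_gr l : e l \in gr (tnth d l).
  rewrite /e; case: ifP => [v_l|_]; last exact: hom_x.
  by rewrite v_degree // hgrv memv_line.
have swap h s1 l m s2 : coefV h (map e (s1 ++ l :: m :: s2))
    = swap_sign K (tnth d l) (tnth d m) * coefV h (map e (s1 ++ m :: l :: s2)).
  rewrite !map_cat /=.
  by have [_ _ sv suv] := coefs_swap (map e s1) (map e s2) (e_gr l) (e_gr m); case: h.
have etE h s : coefV h (map e (map (tperm i j) s)) = coefV h (map e s).
  rewrite -map_comp; congr (coefV h _); apply: eq_map => l /=.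
  by case: tpermP => // ->; rewrite /e vi vj.
have scale h s : coefV h (map (tnth x) s) = (\prod_(l <- s) k l) * coefV h (map e s).
  rewrite (eq_map xE); have [_ _ sv suv] := coefs_scale k e s.
  by case: h.
have := unshuffle_sum_cancel two_neq0 (swap f) (swap g) neq_ij
  (v_degree _ vi) (v_degree _ vj) (etE f) (etE g) le_pn.
move/(congr1 ( *%R (\prod_(l <- enum 'I_n) k l))); rewrite mulr0 mulr_sumr => eq0.
rewrite -[RHS]eq0; apply: eq_bigr => s _.
have -> : \prod_(l <- enum 'I_n) k l = (\prod_(l <- take p (word_of s)) k l)
    * (\prod_(l <- drop p (word_of s)) k l).
  by rewrite -big_cat cat_take_drop; apply/esym/perm_big/perm_word_of.
rewrite !scale; ring.
Qed.

(** Sums of such values do not cancel when the field has characteristic zero. *)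
Definition natural (x : K) := exists m : nat, x = m%:R.

Lemma naturalD x y : natural x -> natural y -> natural (x + y).
Proof. by move=> [m ->] [k ->]; exists (m + k)%N; rewrite natrD. Qed.

Lemma naturalM x y : natural x -> natural y -> natural (x * y).
Proof. by move=> [m ->] [k ->]; exists (m * k)%N; rewrite natrM. Qed.

Lemma natural0 : natural 0. Proof. by exists 0%N. Qed.
Lemma natural1 : natural 1. Proof. by exists 1%N. Qed.

Lemma coefs_natural s : {subset s <= [:: u; w]} ->
  [/\ natural (cW s), natural (cUW s) & all (fun x => cv x == 0) s].
Proof.
have [uu vu wu] := cu_basis; have [uv vv wv] := cv_basis.
have [uw vw ww] := cw_basis.
elim: s => [|x s IHs] sub /=; first by split; [exact: natural1 | exact: natural0 |].
have [IHw IHu ->] : [/\ natural (cW s), natural (cUW s) & all (fun x => cv x == 0) s].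
  by apply: IHs => y sy; rewrite sub // inE sy orbT.
have := sub x (mem_head _ _); rewrite !inE => /orP[]/eqP ->.
  by rewrite uu uv uw eqxx !mul0r mul1r addr0; split=> //; apply: natural0.
by rewrite wu wv ww eqxx !mul1r mul0r add0r.
Qed.

Lemma chi_odd n (d : n.-tuple int) s :
  (forall i, oddz (tnth d i)) -> chi K d s = 1.
Proof.
move=> odd_d; rewrite chi_inversions big1 // => i _; rewrite big1 // => j _.
by rewrite /swap_sign !odd_d.
Qed.

(** With odd entries all signs are [1], so that the terms are natural numbers;
    the identity permutation contributes [1]. *)
Lemma split_sum_neq0 n (d : n.-tuple int) (x : n.-tuple V) F G p :
    [pchar K] =i pred0 -> (forall i, oddz (tnth d i)) ->
    {subset x <= [:: u; w]} ->
    (forall s, {subset s <= [:: u; w]} -> natural (F s)) ->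
    (forall s, {subset s <= [:: u; w]} -> natural (G s)) ->
    F (take p x) = 1 -> G (drop p x) = 1 ->
  split_sum d x F G p != 0.
Proof.
move=> charK odd_d sub natF natG F1 G1.
have unsh1 : unshuffle p (1%g : 'S_n).
  by apply/'forall_forallP => i j; apply/implyP => /andP[]; rewrite !perm1.
rewrite /split_sum (bigD1 _ unsh1) /= chi_odd // word_of1 mul1r.
rewrite map_take map_drop map_tnth_enum F1 G1 mul1r.
suff [m ->] : natural (\sum_(s : 'S_n | unshuffle p s && (s != 1%g)) chi K d s *
    (F [seq tnth x i | i <- take p (word_of s)]
      * G [seq tnth x i | i <- drop p (word_of s)])).
  by rewrite -(natrD _ 1) (pcharf0P K).1.
elim/big_ind: _ => [||s _]; [exact: natural0 | exact: naturalD |].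
by rewrite chi_odd // mul1r; apply: naturalM; [apply: natF | apply: natG];
  move=> _ /mapP[i _ ->]; rewrite sub ?mem_tnth.
Qed.

(** In total arity [m + k] the factors [g p] vanish for [p < m], the factors
    [f (n - p).+1] for [p > m], and only the term [p = m] is left. *)
Lemma leading_term_isolated (f g N : nat -> K) m k (n := (m + k)%N) :
    (forall q, (0 < q < k.+1)%N -> f q = 0) ->
    (forall p, (0 < p < m)%N -> g p = 0) -> (0 < m)%N ->
    g m != 0 -> N m != 0 ->
    \sum_(1 <= p < n.+1) (-1) ^+ (p * (n - p)) * (f (n - p).+1 * (g p * N p)) = 0 ->
  f k.+1 = 0.
Proof.
move=> f0 g0 m_gt0 gm Nm; rewrite (bigD1_seq m) ?iota_uniq //=; last first.
  by rewrite mem_index_iota m_gt0 ltnS leq_addr.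
rewrite big_seq_cond big1 ?addr0 => [|p].
  rewrite /n addKn => /eqP; rewrite !mulf_eq0 (negPf gm) (negPf Nm) !orbF.
  by rewrite signr_eq0 => /eqP.
rewrite mem_index_iota => /andP[/andP[p_gt0 le_pn] neq_pm].
have [lt_pm|le_mp] := ltnP p m; first by rewrite g0 ?p_gt0 // mul0r !mulr0.
by rewrite f0 ?mul0r ?mulr0 // /n; move: le_pn neq_pm; rewrite /n; lia.
Qed.

(** * The two families *)

Section Vanishing.
Variables (a b c : nat -> K) (l : operators V).
Hypotheses (graded_l : graded_operators gr l)
  (given_l : given_by_constants u v w a b c l).

Let deg x : int := if x == u then -1 else 1.

(** On words in [u] and [w], the inner operator can only give a multiple of [v],
    through [b]; the outer one then yields [u] or [w], through [a] or [c]. *)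
Lemma linfty_relations (x : seq V) (d := map_tuple deg (in_tuple x))
    (S := split_sum d (in_tuple x)) (n := size x) :
    Linfty_structure gr l -> (0 < n)%N -> {subset x <= [:: u; w]} ->
  \sum_(1 <= p < n.+1) (-1) ^+ (p * (n - p))
     * (a (n - p).+1 * (b p * S cUW cUW p)) = 0 /\
  \sum_(1 <= p < n.+1) (-1) ^+ (p * (n - p))
     * (c (n - p).+1 * (b p * S cUW cW p)) = 0.
Proof.
move=> [_ jac0] n_gt0 sub.
have hom_x : homogeneous gr d (in_tuple x).
  move=> i; rewrite /d tnth_map /deg.
  have : tnth (in_tuple x) i \in [:: u; w] by apply: sub; apply: mem_tnth.
  rewrite !inE; case: eqP => [->|_]; first by rewrite hgru memv_line.
  by move/eqP => /= ->; rewrite hgrw memv_line.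
have no_v (s : seq 'I_n) : cVW [seq tnth (in_tuple x) i | i <- s] = 0
    /\ cUVW [seq tnth (in_tuple x) i | i <- s] = 0.
  apply: coefs_no_v; suff /coefs_natural[] :
    {subset [seq tnth (in_tuple x) i | i <- s] <= [:: u; w]} by [].
  by move=> _ /mapP[i _ ->]; apply: sub; apply: mem_tnth.
have S0 F p : S cUVW F p = 0 /\ S cVW F p = 0.
  by split; rewrite /S /split_sum big1 // => s _;
    have [v0 uv0] := no_v (take p (word_of s)); rewrite ?v0 ?uv0 mul0r mulr0.
have := jac0 _ d (in_tuple x) n_gt0 hom_x.
rewrite (jacobi_formula _ _ graded_l given_l) -/S -/n => J0.
split.
  have cuE y1 y2 y3 : cu (y1 *: u + y2 *: v + y3 *: w) = y1.
    by case: (coords_comb y1 y2 y3).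
  have := congr1 cu J0; rewrite cuE [cu 0]linear0 => /(congr1 -%R).
  rewrite oppr0 -sumrN => eq0; apply: etrans eq0.
  by apply: eq_bigr => p _; rewrite (S0 cVW p).1 (S0 cUVW p).2; ring.
have cwE y1 y2 y3 : cw (y1 *: u + y2 *: v + y3 *: w) = y3.
  by case: (coords_comb y1 y2 y3).
have := congr1 cw J0; rewrite cwE [cw 0]linear0 => eq0; apply: etrans eq0.
by apply: eq_bigr => p _; rewrite (S0 cVW p).2; ring.
Qed.

Hypothesis charK : [pchar K] =i pred0.

(** The word is chosen as a concatenation so that the identity permutation cuts
    it exactly into the blocks [y] and [z]. *)
Lemma linfty_split_relation (f : nat -> K) G (y z : seq V) :
    f = a /\ G = cUW \/ f = c /\ G = cW ->
    Linfty_structure gr l -> (0 < size y)%N -> {subset y ++ z <= [:: u; w]} ->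
    cUW y = 1 -> G z = 1 ->
    (forall p, (0 < p < size y)%N -> b p = 0) -> b (size y) != 0 ->
    (forall q, (0 < q < (size z).+1)%N -> f q = 0) ->
  f (size z).+1 = 0.
Proof.
move=> fG linf y_gt0 sub Fy Gz b0 bm f0; set x := y ++ z.
have x_gt0 : (0 < size x)%N by rewrite size_cat ltn_addr.
have [relA relC] := linfty_relations linf x_gt0 sub.
pose N := split_sum (map_tuple deg (in_tuple x)) (in_tuple x) cUW G.
apply: (@leading_term_isolated f b N (size y) (size z)) => //.
  apply: split_sum_neq0 => //=.
  - by move=> i; rewrite tnth_map /deg; case: ifP.
  - by move=> s /coefs_natural[].
  - by case: fG => -[_ ->] s /coefs_natural[].
  - by rewrite take_size_cat.
  - by rewrite drop_size_cat.
by rewrite -size_cat -/x /N; case: fG => -[-> ->].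
Qed.

(** Let [m] be minimal with [b m != 0]. The word u w^(m-1) u w^(k-2) isolates
    [a k], and u w^(m-1) w^(k-1) isolates [c k], once all earlier values of [a]
    and [c] are known to vanish. *)
Lemma nontrivial_b_vanishing m : a 1%N = 0 -> Linfty_structure gr l ->
    (0 < m)%N -> b m != 0 -> (forall p, (0 < p < m)%N -> b p = 0) ->
  forall n, (0 < n)%N -> a n = 0 /\ c n = 0.
Proof.
have [uu vu wu] := cu_basis; have [uw vw ww] := cw_basis.
move=> a1 linf; case: m => // m _ bm b0.
pose y := u :: nseq m w; have size_y : size y = m.+1 by rewrite /= size_nseq.
have Fy : cUW y = 1.
  by rewrite /=; have [-> -> _ _] := coefs_w m; rewrite uu uw; ring.
have sub_w k : {subset nseq k w <= [:: u; w]}.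
  by move=> z; rewrite mem_nseq !inE => /andP[_ ->]; rewrite orbT.
have sub_uw k : {subset u :: nseq k w <= [:: u; w]}.
  by move=> z; rewrite inE => /orP[/eqP ->|/sub_w //]; rewrite mem_head.
have sub_cat s t : {subset s <= [:: u; w]} -> {subset t <= [:: u; w]} ->
    {subset s ++ t <= [:: u; w]}.
  by move=> ss st z; rewrite mem_cat => /orP[/ss|/st].
elim/ltn_ind => -[|k] IHk // _; split.
  case: k IHk => [//|k] IHk; pose z := u :: nseq k w.
  have size_z : size z = k.+1 by rewrite /= size_nseq.
  rewrite -size_z; apply: (@linfty_split_relation a cUW y z) => //.
  - by left.
  - by apply: sub_cat; apply: sub_uw.
  - by rewrite /=; have [-> -> _ _] := coefs_w k; rewrite uu uw; ring.
  - by rewrite size_y.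
  - by rewrite size_y.
  by move=> q; rewrite size_z => /andP[q_gt0 lt_q]; case: (IHk q lt_q q_gt0).
have size_z : size (nseq k w) = k by rewrite size_nseq.
rewrite -size_z; apply: (@linfty_split_relation c cW y) => //.
- by right.
- by apply: sub_cat; [apply: sub_uw | apply: sub_w].
- by have [] := coefs_w k.
- by rewrite size_y.
- by rewrite size_y.
by move=> q; rewrite size_z => /andP[q_gt0 lt_q]; case: (IHk q lt_q q_gt0).
Qed.

(** Without [b], both blocks of a nonzero term contain a [v], and such terms
    cancel in pairs. *)
Lemma linfty_of_b0 : (forall n, (0 < n)%N -> b n = 0) -> Linfty_structure gr l.
Proof.
move=> b0; split=> // n d x n_gt0 hom_x.
have two_neq0 : (2 : K) != 0 by rewrite (pcharf0P K).1.
have S0 f g p : (p <= n)%N -> split_sum d x (coefV f) (coefV g) p = 0.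
  exact: split_sum_coefV.
rewrite (jacobi_formula _ _ graded_l given_l).
rewrite !big_nat ![\sum_(_ <= _ < _ | _) _]big1 ?scale0r ?addr0 // => p /andP[p_gt0 le_pn].
- by rewrite b0 // (S0 false false) //; ring.
- by rewrite b0 //; ring.
by rewrite b0 // (S0 true false) // (S0 false true) //; ring.
Qed.

(** The inner operator takes values in multiples of [v], on which the outer one
    vanishes: the Jacobi sum is zero term by term. *)
Lemma linfty_of_ac0 : (forall n, (0 < n)%N -> a n = 0 /\ c n = 0) ->
  Linfty_structure gr l.
Proof.
move=> ac0; split=> // n d x n_gt0 hom_x.
rewrite (jacobi_formula _ _ graded_l given_l).
rewrite !big_nat ![\sum_(_ <= _ < _ | _) _]big1 ?scale0r ?addr0 // => p /andP[p_gt0 le_pn];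
  have [ap cp] := ac0 p p_gt0; have [aq cq] := ac0 (n - p).+1 isT;
  rewrite ?ap ?cp ?aq ?cq; ring.
Qed.
End Vanishing.
End ThreeLines.

Theorem corollary4p9 (K : fieldType) (charK : [pchar K] =i pred0)
  (V : vectType K) (gr : int -> {vspace V}) (u v w : V)
  (hsum : (gr (-1)%R + gr 0%R + gr 1%R)%VS = fullv)
  (hdirect : directv (gr (-1)%R + gr 0%R + gr 1%R)%VS)
  (hother : forall d : int, d \notin [:: -1; 0; 1] -> gr d = 0%VS)
  (hu : u != 0) (hv : v != 0) (hw : w != 0)
  (hgru : gr (-1) = <[u]>%VS) (hgrv : gr 0 = <[v]>%VS)
  (hgrw : gr 1 = <[w]>%VS) :
  (forall (a b c : nat -> K), a 1%N = 0 ->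
     exists l : operators V,
       graded_operators gr l /\ given_by_constants u v w a b c l) /\
  (forall (a b c : nat -> K) (l : operators V), a 1%N = 0 ->
     graded_operators gr l -> given_by_constants u v w a b c l ->
     (Linfty_structure gr l <->
        (forall n, (1 <= n)%N -> b n = 0) \/
        ((exists2 m, (1 <= m)%N & b m != 0) /\
         (forall n, (1 <= n)%N -> a n = 0 /\ c n = 0)))).
Proof.
split=> [a b c _|a b c l a1 graded_l given_l].
  exists (explicit_ops u v w a b c); split.
    exact: (explicit_graded hsum hdirect hother hu hv hw hgru hgrv hgrw).
  exact: (explicit_given hsum hdirect hu hv hw hgru hgrv hgrw).
split=> [linf|[b0|[_ ac0]]]; first last.
- exact: (linfty_of_ac0 hsum hdirect hother hu hv hw hgru hgrv hgrw
           graded_l given_l).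
- exact: (linfty_of_b0 hsum hdirect hother hu hv hw hgru hgrv hgrw
           graded_l given_l charK).
(* The alternative quantifies over all arities: it needs excluded middle. *)
have [ex_b|no_b] := Classical_Prop.classic (exists m, (0 < m)%N && (b m != 0)).
  right; have [m /andP[m_gt0 bm] min_m] := ex_minnP ex_b.
  have b0 p : (0 < p < m)%N -> b p = 0.
    case/andP=> p_gt0; apply: contraTeq => bp; rewrite -leqNgt.
    by rewrite min_m ?p_gt0.
  split; first by exists m.
  exact: (nontrivial_b_vanishing hsum hdirect hother hu hv hw hgru hgrv hgrw
            graded_l given_l charK a1 linf m_gt0 bm b0).
left=> n n_gt0; apply/eqP; apply/negPn/negP => bn; case: no_b.
by exists n; rewrite n_gt0.
Qed.
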